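(* Given the involutive sandwich pair $\big(\mathrm{MD}_{\alpha,\beta,\gamma}(n),\mathrm{MD}_1(n)\big)$, the ranks of (some of the) Gram matrices are as follows. (i) $\mathrm{rank}_{\mathbb K}(\mathrm G^n)=1$ whenever $n\in\mathcal P^{ap}$. Furthermore, assume that $$\sum_{k\ge0}\alpha_kT^k=\frac{\alpha_0}{1-T},\qquad\sum_{k\ge0}\beta_kT^k=\frac{\beta_0}{1-T},\qquad\sum_{k\ge0}\gamma_kT^k=\frac{\gamma_0}{1-T},$$ so that $r=K=1$. Then: (ii) For $\mathrm{MD}_1(n)\in\{\mathrm{MRo}_1(n),\mathrm{MRo}_1^p(n)\}$ we have $\mathrm{rank}_{\mathbb K}(\mathrm G^\lambda)=\binom n\lambda\cdot3^{n-\lambda}$ for $\lambda\in\mathcal P^{ap}$ in case that $$\Bigg[\prod_{i=1}^{\bar\lambda}\Big((\alpha_0^i-\gamma_0^i)-\sum_{k=1}^{i-1}\binom ik\big(\alpha_0^{i-k}\gamma_0^k-\gamma_0^i\big)\Big)^{\binom{\bar\lambda}{i}\cdot2^{\bar\lambda-i}}\Bigg](\gamma_0^2-\beta_0^2)^{\bar\lambda\cdot3^{\bar\lambda-1}}\neq0,\qquad(\ast)$$ where $\bar\lambda=n-\lambda$. (iii) For $\mathrm{MD}_1(n)\in\{\mathrm{MRoBr}_1(n),\mathrm{MMo}_1(n)\}$ and $n-1\in\mathcal P^{ap}$, which also satisfies $(\ast)$ (with $\lambda=n-1$), we have $\mathrm{rank}_{\mathbb K}(\mathrm G^{n-1})=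3n$.
   Context: Parameters. $\mathbb K$ is an arbitrary field. Fix a positive odd integer $r$ and $p_\alpha,p_\beta,p_\gamma\in\mathbb K[T]$, put $K=\max(\deg p_\alpha+1,r)$ and assume $\deg p_\beta,\deg p_\gamma<K$. Write $p_\alpha(T)/(1-T^r)=\sum_{k\ge0}\alpha_kT^k$, and similarly define $\beta_k,\gamma_k$ from $p_\beta,p_\gamma$. Let $\mathcal M=\langle a,b\mid ab=ba,\ ab=b^3,\ a^K=a^{K-r}\rangle$ (a monoid). Decorated diagrams. A decorated partition diagram from $n$ to $m$ is a set partition of $\{1,\dots,n\}\cup\{1',\dots,m'\}$ (unprimed points at the bottom, primed at the top) together with, for every block, a number $g\in\{0,\dots,K-1\}$ of handle dots and a number $c\in\{0,1,2\}$ of Möbius dots. The composition $x\circ y$ stacks $x$ on top of $y$; a connected component formed from $s$ blocks glued along $t$ middle points gets $g=\sum g_i+(t-s+1)$ handle dots and $c=\sum c_i$ Möbius dots, after which one applies $(g,c)\mapsto(g+1,c-2)$ while $c\ge3$ and $(g,c)\mapsto(g-r,c)$ while $g\ge K$. A closed component with data $(g,c)$ is removed and replaced by the scalar $\alpha_g$ if $c=0$, $\beta_g$ if $c=1$, $\gamma_g$ if $c=2$. (For $r=K=1$ there are no handle dots.) Families. $\mathrm{MD}_1(n)$ is the set of decorated diagrams from $n$ to $n$ with underlying partition in one of: $\mathrm{Pa}$ (all partitions), $\mathrm{RoBr}$ (blocks of size $1$ or $2$), $\mathrm{Br}$ (blocks of size $2$), $\mathrm{Ro}$ (each block has at most one bottom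 and at most one top point), $\mathrm S_n$ (permutations); or the planar elements of these, $\mathrm{Pa}^p,\mathrm{Mo},\mathrm{TL},\mathrm{Ro}^p,\mathrm S_n^p$ respectively. The decorated versions are written with a prefix $\mathrm M$. $\mathrm{MD}_{\alpha,\beta,\gamma}(n)$ is the $\mathbb K$-algebra with basis $\mathrm{MD}_1(n)$ and multiplication $\circ$. Cell structure. A through strand is a block with both bottom and top points. A diagram with $\lambda$ through strands is determined by its top (the partition of the top points, with the through blocks marked and the dots on the top-only blocks), its bottom (the analogous bottom data), and its middle, an element of $\mathcal M\wr S_\lambda$ (of $\mathcal M^\lambda$ in the planar case) recording how the through blocks are connected and their dots. The right cells $\mathcal R_\lambda$ (left cells $\mathcal L_\lambda$) with $\lambda$ through strands are indexed by the tops (bottoms), and $\mathcal H_{ij}$ is the set of diagrams with $\lambda$ through strands, top $i$ and bottom $j$. Gram matrix. $\mathrm G^\lambda$ is the $(\#\mathcal R_\lambda)\times(\#\mathcal L_\lambda)$-matrix over $\mathbb K$ with $(\mathrm G^\lambda)_{i,j}=s(e)$ if there exists $e\in\mathcal H_{ij}$ with $e^2=s(e)\cdot e$, $s(e)\in\mathbb K\setminus\{0\}$ (such an $e$ is then unique), and $(\mathrm G^\lambda)_{i,j}=0$ otherwise. Apex. A simple $\mathrm{MD}_{\alpha,\beta,\gamma}(n)$-module has apex $\lambda$ if $\lambda$ is the smallest integer such that the span of the diagrams with exactly $\lambda$ through strands does not annihilate it; $\mathcal P^{ap}$ is the set of all apexes of simple modules. *)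

(* Defs.v *)
From HB Require Import structures.
From mathcomp Require Import all_boot all_order all_algebra.

Set Implicit Arguments.
Unset Strict Implicit.
Unset Printing Implicit Defensive.

Import GRing.Theory.
Local Open Scope ring_scope.

(* [expansion u p q]: the formal power series \sum_k u_k T^k equals p / q, i.e.
   its Cauchy product with q is p.  This determines u as soon as q`_0 is
   nonzero, which is the case for q = 1 - 'X^r with r > 0. *)
Definition expansion (F : fieldType) (u : nat -> F) (p q : {poly F}) : Prop :=
  forall k : nat, \sum_(i < k.+1) q`_i * u (k - i)%N = p`_k.

(* Pairs (g, c) : g handle dots and c Moebius dots. *)
Definition dot_step (r K : nat) (gc : nat * nat) : nat * nat :=
  let: (g, c) := gc in
  if (3 <= c)%N then (g.+1, (c - 2)%N)
  else if (K <= g)%N then ((g - r)%N, c) else (g, c).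

(* For 0 < r <= K every effective step decreases g + c, so that g + c steps
   reach the normal form. *)
Definition dot_reduce (r K : nat) (gc : nat * nat) : nat * nat :=
  iter (gc.1 + gc.2) (dot_step r K) gc.

Lemma dot_reduceP (r K : nat) (gc : nat * nat) : (0 < r <= K)%N ->
  ((dot_reduce r K gc).1 < K)%N && ((dot_reduce r K gc).2 < 3)%N.
Proof.
move=> /andP[r0 rK]; have K0 := leq_trans r0 rK; rewrite /dot_reduce.
suff H m g c : (g + c <= m)%N ->
    let gc' := iter m (dot_step r K) (g, c) in (gc'.1 < K)%N && (gc'.2 < 3)%N.
  by case: gc => g c; apply: H.
elim: m g c => [|m IH] g c.
  by rewrite leqn0 addn_eq0 => /andP[/eqP-> /eqP->]; rewrite /= K0.
rewrite iterSr [dot_step _ _ _]/= => gcm; case: (leqP 3 c) => c3.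
  case: c gcm c3 => [|[|[|c]]] // gcm _; apply: IH.
  by rewrite subSS subSS subn0 addSn addnS; rewrite !addnS in gcm.
case: (leqP K g) => Kg.
  apply: IH; rewrite -ltnS (leq_trans _ gcm) // ltn_add2r.
  by rewrite ltn_subrL r0 (leq_trans K0).
have -> : iter m (dot_step r K) (g, c) = (g, c).
  by apply: iter_fix => /=; rewrite leqNgt c3 leqNgt Kg.
by rewrite /= Kg c3.
Qed.

Definition dots (K : nat) : Type := ('I_K * 'I_3)%type.
HB.instance Definition _ K := Finite.on (dots K).

(* A diagram from n (bottom points, [inl]) to m (top points, [inr]) is stored as
   the partial function from sets of points to dots whose domain is the set of
   its blocks and whose values are the decorations of the blocks.  A prediagram is
   such a partial function without the partition condition. *)
Definition prediagram (K n m : nat) : Type :=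
  {ffun {set 'I_n + 'I_m} -> option (dots K)}.
HB.instance Definition _ K n m := Finite.on (prediagram K n m).

Section Diagrams.

Variables (r K : nat).

Section Shape.

Variables (n m : nat).
Implicit Types (x : prediagram K n m) (B : {set 'I_n + 'I_m}).

Definition blocks x : {set {set 'I_n + 'I_m}} := [set B | isSome (x B)].

Definition handles x B : nat := if x B is Some (g, _) then val g else 0%N.
Definition moebius x B : nat := if x B is Some (_, c) then val c else 0%N.

Definition bot_part B : {set 'I_n} := [set i | inl i \in B].
Definition top_part B : {set 'I_m} := [set j | inr j \in B].

Definition is_diagram x : bool := partition (blocks x) [set: 'I_n + 'I_m].

Definition is_through B : bool := (bot_part B != set0) && (top_part B != set0).
Definition through_blocks x : {set {set 'I_n + 'I_m}} :=
  [set B in blocks x | is_through B].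
Definition through x : nat := #|through_blocks x|.

(* Position on the boundary of the strip: bottom from left to right, then top
   from right to left.  A diagram can be drawn in the strip without crossings
   iff its partition is noncrossing for this cyclic order. *)
Definition boundary_pos (v : 'I_n + 'I_m) : nat :=
  match v with inl i => i | inr j => (n + (m - j.+1))%N end.

Definition is_planar x : bool :=
  [forall B in blocks x, forall C in blocks x,
    [exists a in B, exists b in C, exists c in B, exists d in C,
      [&& boundary_pos a < boundary_pos b, boundary_pos b < boundary_pos c
        & boundary_pos c < boundary_pos d]%N] ==> (B == C)].

(* Half diagrams: the set of (top or bottom parts of) through blocks, and the
   remaining blocks with their dots. *)
Definition half_diagram (k : nat) : Type :=
  ({set {set 'I_k}} * {ffun {set 'I_k} -> option (dots K)})%type.

Definition top_half x : half_diagram m :=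
  ([set top_part B | B in through_blocks x],
   [ffun C : {set 'I_m} => x [set inr j | j in C]]).
Definition bottom_half x : half_diagram n :=
  ([set bot_part B | B in through_blocks x],
   [ffun C : {set 'I_n} => x [set inl i | i in C]]).

End Shape.

HB.instance Definition _ k := Finite.on (half_diagram k).

Section Composition.

(* x from m to p is stacked on top of y from n to m. *)
Variables (n m p : nat) (x : prediagram K m p) (y : prediagram K n m).

(* Bottom, middle and top points of the stacked picture. *)
Let stacked : finType := ('I_n + 'I_m + 'I_p)%type.

Definition in_lower (v : 'I_n + 'I_m) : 'I_n + 'I_m + 'I_p := inl v.
Definition in_upper (v : 'I_m + 'I_p) : 'I_n + 'I_m + 'I_p :=
  match v with inl k => inl (inr k) | inr j => inr j end.
Definition in_outer (v : 'I_n + 'I_p) : 'I_n + 'I_m + 'I_p :=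
  match v with inl i => inl (inl i) | inr j => inr j end.

Definition glued : rel stacked := fun u v =>
  [exists B in blocks y, (u \in in_lower @: B) && (v \in in_lower @: B)]
  || [exists C in blocks x, (u \in in_upper @: C) && (v \in in_upper @: C)].

Definition components : {set {set stacked}} :=
  [set [set v | connect glued u v] | u : stacked].

Definition lower_blocks (Z : {set stacked}) : {set {set 'I_n + 'I_m}} :=
  [set B in blocks y | in_lower @: B \subset Z].
Definition upper_blocks (Z : {set stacked}) : {set {set 'I_m + 'I_p}} :=
  [set C in blocks x | in_upper @: C \subset Z].
Definition middle_points (Z : {set stacked}) : {set 'I_m} :=
  [set k : 'I_m | inl (inr k) \in Z].
Definition outer_points (Z : {set stacked}) : {set 'I_n + 'I_p} :=
  in_outer @^-1: Z.

(* Z is connected, so s <= t + 1 and the truncated subtraction is harmless. *)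
Definition component_dots (Z : {set stacked}) : nat * nat :=
  let s := (#|lower_blocks Z| + #|upper_blocks Z|)%N in
  let t := #|middle_points Z| in
  let g := (\sum_(B in lower_blocks Z) handles y B
            + \sum_(C in upper_blocks Z) handles x C + (t.+1 - s))%N in
  let c := (\sum_(B in lower_blocks Z) moebius y B
            + \sum_(C in upper_blocks Z) moebius x C)%N in
  dot_reduce r K (g, c).

(* [insub] succeeds and [inord] does not truncate, by dot_reduceP. *)
Definition compose : prediagram K n p :=
  [ffun B : {set 'I_n + 'I_p} =>
    if [pick Z in components | (B != set0) && (outer_points Z == B)] is Some Z
    then omap (fun g : 'I_K => (g, inord (component_dots Z).2))
              (insub (component_dots Z).1)
    else None].

Definition closed_components : {set {set stacked}} :=
  [set Z in components | outer_points Z == set0].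

Definition closed_scalar (F : fieldType) (al be ga : nat -> F) : F :=
  \prod_(Z in closed_components)
    match component_dots Z with
    | (g, 0) => al g
    | (g, 1) => be g
    | (g, _) => ga g
    end.

End Composition.

Definition identity_diagram (n : nat) : prediagram K n n :=
  [ffun B => if [exists i : 'I_n, B == [set inl i; inr i]]
             then omap (fun g : 'I_K => (g, ord0)) (insub 0%N) else None].

End Diagrams.

Inductive diagram_family := Pa | RoBr | Br | Ro | Sn | PaP | Mo | TL | RoP | SnP.

(* Condition on a single block of the underlying partition. *)
Definition block_shape (f : diagram_family) (n : nat) (B : {set 'I_n + 'I_n}) : bool :=
  match f with
  | Pa | PaP => true
  | RoBr | Mo => #|B| <= 2
  | Br | TL => #|B| == 2
  | Ro | RoP => (#|bot_part B| <= 1) && (#|top_part B| <= 1)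
  | Sn | SnP => (#|bot_part B| == 1) && (#|top_part B| == 1)
  end%N.

Definition planar_family (f : diagram_family) : bool :=
  match f with PaP | Mo | TL | RoP | SnP => true | _ => false end.

Definition in_family (f : diagram_family) (K n : nat) (x : prediagram K n n) : bool :=
  [&& is_diagram x, [forall B in blocks x, block_shape f B]
    & planar_family f ==> is_planar x].

(* The set MD_1(n). *)
Record diagram (f : diagram_family) (K n : nat) := Diagram {
  dval :> prediagram K n n;
  _ : in_family f dval
}.
HB.instance Definition _ f K n := [isSub for @dval f K n].
HB.instance Definition _ f K n := [Finite of diagram f K n by <:].

Section Algebra.

Variables (F : fieldType) (r K : nat) (al be ga : nat -> F).
Variables (f : diagram_family) (n : nat).

Local Notation D := (diagram f K n).

(* The vector space with basis MD_1(n); a function is the family of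
   coefficients. *)
Definition md_algebra : Type := {ffun D -> F^o}.
HB.instance Definition _ := GRing.Lmodule.on md_algebra.

Definition basis_elt (d : D) : md_algebra := [ffun e => (e == d)%:R].

(* The bilinear extension of x * y = closed_scalar x y . (x o y); each family is
   closed under composition, so every product of basis elements occurs. *)
Definition md_mul (a b : md_algebra) : md_algebra :=
  [ffun z : D => \sum_(x : D) \sum_(y : D | compose r x y == z :> prediagram K n n)
     a x * b y * closed_scalar r x y al be ga].

Definition md_one : md_algebra :=
  [ffun z : D => ((z : prediagram K n n) == identity_diagram K n)%:R].

Record md_module := MdModule {
  md_space :> lmodType F;
  md_act : md_algebra -> md_space -> md_space;
  md_actDl : forall a b v, md_act (a + b) v = md_act a v + md_act b v;
  md_actZl : forall (k : F) a v, md_act (k *: a) v = k *: md_act a v;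
  md_actDr : forall a v w, md_act a (v + w) = md_act a v + md_act a w;
  md_actZr : forall (k : F) a v, md_act a (k *: v) = k *: md_act a v;
  md_actM : forall a b v, md_act (md_mul a b) v = md_act a (md_act b v);
  md_act1 : forall v, md_act md_one v = v
}.

Definition is_submodule (V : md_module) (W : V -> Prop) : Prop :=
  [/\ W 0,
      forall v w, W v -> W w -> W (v + w),
      forall (k : F) v, W v -> W (k *: v)
    & forall a v, W v -> W (md_act a v)].

Definition is_simple (V : md_module) : Prop :=
  (exists v : V, v <> 0) /\
  forall W : V -> Prop, is_submodule W ->
    (forall v, W v -> v = 0) \/ (forall v, W v).

(* a lies in the span of the diagrams with exactly l through strands. *)
Definition in_through_span (l : nat) (a : md_algebra) : Prop :=
  forall d : D, a d != 0 -> through d = l.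

Definition annihilated_by (l : nat) (V : md_module) : Prop :=
  forall a : md_algebra, in_through_span l a -> forall v : V, md_act a v = 0.

Definition has_apex (V : md_module) (l : nat) : Prop :=
  ~ annihilated_by l V /\ forall k, (k < l)%N -> annihilated_by k V.

Definition is_apex (l : nat) : Prop :=
  exists2 V : md_module, is_simple V & has_apex V l.

(* The index sets of the right and left cells with l through strands. *)
Definition cell_tops (l : nat) : {set half_diagram K n} :=
  [set top_half (d : prediagram K n n) | d : D & through d == l].
Definition cell_bottoms (l : nat) : {set half_diagram K n} :=
  [set bottom_half (d : prediagram K n n) | d : D & through d == l].

Definition Hcell (l : nat) (i j : half_diagram K n) : {set D} :=
  [set d : D | [&& through d == l, top_half d == i & bottom_half d == j]].

(* If e^2 = s(e) . e for a diagram e, then s(e) is the coefficient of e in e^2. *)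
Definition sq_coef (e : D) : F := md_mul (basis_elt e) (basis_elt e) e.

(* sq_coef e only depends on (i, j), so the choice made by [pick] is
   irrelevant: the closed components in e o e only involve the bottom-only blocks
   of j and the top-only blocks of i. *)
Definition gram_entry (l : nat) (i j : half_diagram K n) : F :=
  if [pick e in Hcell l i j |
        (sq_coef e != 0) &&
        (md_mul (basis_elt e) (basis_elt e) == sq_coef e *: basis_elt e)]
  is Some e then sq_coef e else 0.

Definition gram (l : nat) : 'M[F]_(#|cell_tops l|, #|cell_bottoms l|) :=
  \matrix_(i, j) gram_entry l (enum_val i) (enum_val j).

End Algebra.

(* The left-hand side of the nonvanishing condition, with lb = n - lambda,
   a = alpha_0, b = beta_0 and c = gamma_0.  For lb = 0 the exponent
   lb * 3 ^ (lb - 1) is 0. *)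
Definition rank_condition (F : fieldType) (a b c : F) (lb : nat) : F :=
  (\prod_(1 <= i < lb.+1)
     ((a ^+ i - c ^+ i)
      - \sum_(1 <= k < i) 'C(i, k)%:R * (a ^+ (i - k) * c ^+ k - c ^+ i))
     ^+ ('C(lb, i) * 2 ^ (lb - i)))
  * (c ^+ 2 - b ^+ 2) ^+ (lb * 3 ^ lb.-1).

(* Main.v *)
Require Import Defs.
From HB Require Import structures.
From mathcomp Require Import all_boot all_order all_algebra.
From mathcomp Require Import zify ring.
Import GRing.Theory.
Local Open Scope ring_scope.

(** Every half diagram that occurs here comes from a diagram in which a block has
    at most one bottom point and at most one top point (rook-shaped).  This is
    part of the definition of the rook families; with n through strands it holds
    in every family, and with n - 1 through strands it holds as soon as blocks
    have at most two points, by counting points ([rook_full],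
    [rook_almost_full]).

    A rook-shaped half diagram with l marked points is a labelling of the n
    boundary points by [None] (l times, on the marked points) or by the dots of a
    singleton block, so there are 'C(n, l) * (3 K) ^ (n - l) tops, and as many
    bottoms.  If a rook-shaped diagram e with top v and bottom w satisfies
    e o e = e, then v and w mark the same points: otherwise some through strand of
    the upper copy of e ends on a middle point at which the lower copy has a
    singleton, and its top point becomes a singleton in e o e.  When v and w mark
    the same points, the closed components of e o e are the unmarked middle
    points, so that the scalar of e is the product over these points k of a
    pairing of the dots v k and w k; it depends on v and w only.  Conversely the
    diagram with vertical undotted through strands, top v and bottom w is an
    idempotent partition diagram, and it is planar.  Hence
    ([gram_entryE])
      G (v, w) = prod_k N (v k) (w k),
    where N is 1 on the pair of marked labels, 0 on mixed pairs, and the pairing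
    of dots on unmarked labels.

    So G is block diagonal, with one block for each set of l marked points, equal
    to the (n - l)-th Kronecker power of the pairing matrix of dots; it is
    invertible when that matrix is, or when l = n ([gram_rank]).  For l = n the
    rank is 1.  For r = K = 1 there are only the dots 0, 1, 2, whose pairing
    matrix has rows (a, b, c), (b, c, b), (c, b, c) and determinant
    (a - c) (c ^ 2 - b ^ 2).  The condition on the parameters
    contains, when l < n, both factors with positive exponents: the first one as
    the factor i = 1 of the product.  The rank is then 'C(n, l) * 3 ^ (n - l). *)

Set Implicit Arguments.
Unset Strict Implicit.
Unset Printing Implicit Defensive.

(** * Blocks of a diagram *)

Section Blocks.

Variables (K n m : nat) (d : prediagram K n m).
Hypothesis d_diag : is_diagram d.

Lemma block_neq0 B : B \in blocks d -> B != set0.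
Proof. by move=> Bd; apply: contraTneq Bd => ->; case/and3P: d_diag. Qed.

Lemma mem_block a : exists2 B, B \in blocks d & a \in B.
Proof.
have /and3P[/eqP cv _ _] := d_diag.
have: a \in cover (blocks d) by rewrite cv inE.
by rewrite /cover => /bigcupP[B Bd aB]; exists B.
Qed.

Lemma block_inj B C a :
  B \in blocks d -> C \in blocks d -> a \in B -> a \in C -> B = C.
Proof.
have /and3P[_ tI _] := d_diag => Bd Cd aB aC.
by rewrite -(def_pblock tI Bd aB) (def_pblock tI Cd aC).
Qed.

Lemma block_subset B C : B \in blocks d -> C \in blocks d -> B \subset C -> B = C.
Proof.
move=> Bd Cd BC; have /set0Pn[a aB] := block_neq0 Bd.
exact: block_inj Bd Cd aB (subsetP BC a aB).
Qed.

Lemma block1_eq B a :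
  [set a] \in blocks d -> B \in blocks d -> a \in B -> B = [set a].
Proof. by move=> ad Bd aB; apply: block_inj Bd ad aB _; rewrite inE. Qed.

(** Distinct blocks meet the points h k in disjoint nonempty sets of indices; those
    other than B use at least one index each, outside the ones used by B. *)
Lemma card_blocks_meeting (h : 'I_n -> 'I_n + 'I_m)
    (S : {set {set 'I_n + 'I_m}}) B :
  S \subset blocks d -> B \in blocks d ->
  (forall C, C \in S -> h @^-1: C != set0) ->
  (#|S :\ B| + #|h @^-1: B| <= n)%N.
Proof.
move=> Sd Bd meet; rewrite -[X in (_ <= X)%N](card_ord n) -(cardsC (h @^-1: B)).
rewrite addnC leq_add2l.
apply: leq_trans (leq_imset_card (pblock (blocks d) \o h) _).
apply/subset_leq_card/subsetP => C; rewrite !inE => /andP[CB CS].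
have /set0Pn[i] := meet C CS; rewrite inE => iC.
have Cd := subsetP Sd C CS.
apply/imsetP; exists i.
  by rewrite !inE; apply: contraNN CB => iB; rewrite (block_inj Bd Cd iB iC).
by case/and3P: d_diag => _ tI _; rewrite /= (def_pblock tI Cd iC).
Qed.

End Blocks.

(** * Labellings of boundary points *)

Section Labellings.

Variables (K n : nat).

Local Notation labelling := {ffun 'I_n -> option (dots K)}.

Implicit Types v w : labelling.

(** A labelling v encodes a half diagram all of whose blocks are single points:
    [None] marks a point on a through strand, [Some o] a singleton block with
    dots o. *)
Definition strands v : {set 'I_n} := [set k | v k == None].

Definition labellings (l : nat) : {set labelling} := [set v | #|strands v| == l].

(** The half diagram encoded by v, and the decoding map [label_of]. *)
Definition half_of v : half_diagram K n :=
  ([set [set k] | k in strands v],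
   [ffun C : {set 'I_n} => if [pick k | C == [set k]] is Some k then v k else None]).

Definition label_of (t : half_diagram K n) : labelling := [ffun k => t.2 [set k]].

Lemma pick_set1 (aT rT : finType) (h : aT -> rT) (a : aT) :
  injective h -> [pick k | [set h a] == [set h k]] = Some a.
Proof.
by move=> hI; case: pickP => [k /eqP/set1_inj/hI-> // | /(_ a)]; rewrite eqxx.
Qed.

Lemma half_ofK : cancel half_of label_of.
Proof. by move=> v; apply/ffunP => k; rewrite !ffunE (pick_set1 (h := id)). Qed.

Lemma card_labellings_strands (A : {set 'I_n}) :
  #|[set v | strands v == A]| = ((K * 3) ^ (n - #|A|))%N.
Proof.
have -> : (n - #|A|)%N = #|~: A| by rewrite [RHS]cardsCs setCK card_ord.
have -> : (K * 3)%N = #|predC1 (@None (dots K))|.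
  by rewrite cardC1 card_option card_prod !card_ord.
rewrite -(card_pffun_on None); apply: eq_card => v; rewrite inE.
apply/eqP/pffun_onP => [<- | [sv vA]].
  split; first by apply/subsetP => k; rewrite !inE.
  by move=> o /imageP[k]; rewrite !inE => vk ->.
apply/setP => k; rewrite inE; apply/idP/idP => [vk | kA].
  apply: contraTT vk => nkA; suff: v k \in predC1 None by rewrite !inE.
  by apply/vA/image_f; rewrite inE.
by have := subsetP sv k; rewrite !inE kA; case: eqP => // _ /(_ isT).
Qed.

Lemma card_labellings l : #|labellings l| = ('C(n, l) * (K * 3) ^ (n - l))%N.
Proof.
rewrite -sum1_card (partition_big strands (fun A => #|A| == l)) => [|v]; last first.
  by rewrite inE.
rewrite (eq_bigr (fun=> (K * 3) ^ (n - l))%N) => [|A /eqP Al].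
  have <- : #|[set A : {set 'I_n} | #|A| == l]| = 'C(n, l).
    by rewrite card_draws card_ord.
  rewrite sum_nat_const; congr (_ * _)%N.
  by apply: eq_card => A; rewrite !inE.
rewrite -Al -card_labellings_strands -[RHS]sum1_card; apply: eq_bigl => v.
by rewrite !inE; case: (strands v =P A) => [-> | _]; rewrite ?eqxx ?andbF.
Qed.

End Labellings.

(** * Rook-shaped diagrams *)

Section Rook.

Variables (K n : nat) (d : prediagram K n n).

(** Each block has at most one bottom point and at most one top point. *)
Definition rook_shaped : bool :=
  [forall B in blocks d, (#|bot_part B| <= 1) && (#|top_part B| <= 1)]%N.

(** In a rook-shaped diagram a top point k lies on a through strand or forms the
    block {inr k}; the value of the diagram at {inr k} is [None] in the first
    case and the dots of the block in the second one.  Similarly at the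
    bottom. *)
Definition top_label : {ffun 'I_n -> option (dots K)} := [ffun k => d [set inr k]].
Definition bottom_label : {ffun 'I_n -> option (dots K)} := [ffun k => d [set inl k]].

Lemma bot_partE (B : {set 'I_n + 'I_n}) : bot_part B = inl @^-1: B.
Proof. by apply/setP => i; rewrite !inE. Qed.

Lemma top_partE (B : {set 'I_n + 'I_n}) : top_part B = inr @^-1: B.
Proof. by apply/setP => i; rewrite !inE. Qed.

Hypothesis d_diag : is_diagram d.
Hypothesis d_rook : rook_shaped.

Lemma rook_bot B i j : B \in blocks d -> inl i \in B -> inl j \in B -> i = j.
Proof.
move=> Bd iB jB; have /andP[/card_le1_eqP b1 _] := forall_inP d_rook B Bd.
by apply: b1; rewrite inE.
Qed.

Lemma rook_top B i j : B \in blocks d -> inr i \in B -> inr j \in B -> i = j.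
Proof.
move=> Bd iB jB; have /andP[_ /card_le1_eqP b1] := forall_inP d_rook B Bd.
by apply: b1; rewrite inE.
Qed.

Lemma rook_throughE B i j :
  B \in blocks d -> inl i \in B -> inr j \in B -> B = [set inl i; inr j].
Proof.
move=> Bd iB jB; apply/setP => -[] k; rewrite !inE; apply/idP/orP => [kB | []/eqP//[->]//].
  by left; rewrite (rook_bot Bd kB iB).
by right; rewrite (rook_top Bd kB jB).
Qed.

Lemma top_label_through B k :
  B \in blocks d -> inr k \in B -> (d [set inr k] == None) = is_through B.
Proof.
move=> Bd kB; apply/idP/andP => [dk | [/set0Pn[i iB] _]].
  split; apply/set0Pn; last by exists k; rewrite inE.
  suff /existsP[i iB]: [exists i, inl i \in B] by exists i; rewrite inE.
  apply: contraTT dk; rewrite negb_exists => /forallP nB.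
  have <- : B = [set inr k]; last by move: Bd; rewrite inE; case: (d B).
  apply/setP => -[] i; rewrite !inE; first exact: negPf (nB i).
  by apply/idP/eqP => [iB | [->] //]; rewrite (rook_top Bd iB kB).
rewrite inE in iB; case dk: (d _) => [o|] //.
have kd : [set inr k] \in blocks d by rewrite inE dk.
by move: iB; rewrite (block1_eq d_diag kd Bd kB) inE.
Qed.

Lemma bottom_label_through B k :
  B \in blocks d -> inl k \in B -> (d [set inl k] == None) = is_through B.
Proof.
move=> Bd kB; apply/idP/andP => [dk | [_ /set0Pn[i iB]]].
  split; apply/set0Pn; first by exists k; rewrite inE.
  suff /existsP[i iB]: [exists i, inr i \in B] by exists i; rewrite inE.
  apply: contraTT dk; rewrite negb_exists => /forallP nB.
  have <- : B = [set inl k]; last by move: Bd; rewrite inE; case: (d B).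
  apply/setP => -[] i; rewrite !inE; last exact: negPf (nB i).
  by apply/idP/eqP => [iB | [->] //]; rewrite (rook_bot Bd iB kB).
rewrite inE in iB; case dk: (d _) => [o|] //.
have kd : [set inl k] \in blocks d by rewrite inE dk.
by move: iB; rewrite (block1_eq d_diag kd Bd kB) inE.
Qed.

Lemma top_label_None k :
  top_label k = None -> exists i, [set inl i; inr k] \in blocks d.
Proof.
have [B Bd kB] := mem_block d_diag (inr k).
move/eqP; rewrite ffunE (top_label_through Bd kB) => /andP[/set0Pn[i]].
by rewrite inE => iB _; exists i; rewrite -(rook_throughE Bd iB kB).
Qed.

Lemma bottom_label_None k :
  bottom_label k = None -> exists i, [set inl k; inr i] \in blocks d.
Proof.
have [B Bd kB] := mem_block d_diag (inl k).
move/eqP; rewrite ffunE (bottom_label_through Bd kB) => /andP[_ /set0Pn[i]].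
by rewrite inE => iB; exists i; rewrite -(rook_throughE Bd kB iB).
Qed.

(** Common treatment of the two sides of the strip: h is [inl] or [inr]. *)
Section Side.

Variable h : 'I_n -> 'I_n + 'I_n.
Hypothesis h_rook : forall B i j, B \in blocks d -> h i \in B -> h j \in B -> i = j.
Hypothesis h_through : forall B k, B \in blocks d -> h k \in B ->
  (d [set h k] == None) = is_through B.
Hypothesis through_h : forall B, is_through B -> h @^-1: B != set0.

Let v : {ffun 'I_n -> option (dots K)} := [ffun k => d [set h k]].

Let strands_through : [set [set k] | k in strands v] =
                      [set h @^-1: (B : {set _}) | B in through_blocks d].
Proof.
have part1 B k : B \in blocks d -> h k \in B -> h @^-1: B = [set k].
  move=> Bd kB; apply/setP => j; rewrite !inE.
  by apply/idP/eqP => [jB | -> //]; apply: h_rook jB kB.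
apply/setP => C; apply/imsetP/imsetP => [[k + ->] | [B + ->]].
  rewrite inE ffunE; have [B Bd kB] := mem_block d_diag (h k).
  by rewrite (h_through Bd kB) => tB; exists B; [rewrite inE Bd | rewrite (part1 B k)].
rewrite inE => /andP[Bd tB]; have /set0Pn[k] := through_h tB; rewrite inE => kB.
by exists k; [rewrite inE ffunE (h_through Bd kB) | apply: part1].
Qed.

Lemma side_half :
  ([set h @^-1: (B : {set _}) | B in through_blocks d], [ffun C : {set 'I_n} => d (h @: C)])
  = half_of v.
Proof.
congr pair; first by rewrite strands_through.
apply/ffunP => C; rewrite !ffunE.
case: pickP => [k /eqP-> | nC]; first by rewrite ffunE imset_set1.
case dC: (d _) => [o|] //.
have Cd : h @: C \in blocks d by rewrite inE dC.
have /set0Pn[_ /imsetP[k kC _]] := block_neq0 d_diag Cd.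
have /eqP[] := nC k; apply/setP => j; rewrite inE.
by apply/idP/eqP => [jC | -> //]; apply: h_rook Cd _ _; apply: imset_f.
Qed.

Lemma side_through : #|strands v| = through d.
Proof.
rewrite -(card_imset _ set1_inj) strands_through card_in_imset // => B C.
case/setIdP=> Bd /through_h/set0Pn[k]; rewrite inE => kB /setIdP[Cd _] BC.
by apply: (block_inj d_diag Bd Cd kB); move/setP/(_ k): BC; rewrite !inE kB.
Qed.

End Side.

Lemma through_bot (B : {set 'I_n + 'I_n}) : is_through B -> inl @^-1: B != set0.
Proof. by case/andP; rewrite bot_partE. Qed.

Lemma through_top (B : {set 'I_n + 'I_n}) : is_through B -> inr @^-1: B != set0.
Proof. by case/andP; rewrite top_partE. Qed.

Lemma rook_top_half : top_half d = half_of top_label.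
Proof.
rewrite -(side_half rook_top top_label_through through_top).
by congr pair; apply: eq_imset => B; rewrite top_partE.
Qed.

Lemma rook_bottom_half : bottom_half d = half_of bottom_label.
Proof.
rewrite -(side_half rook_bot bottom_label_through through_bot).
by congr pair; apply: eq_imset => B; rewrite bot_partE.
Qed.

Lemma card_top_strands : #|strands top_label| = through d.
Proof. exact: side_through rook_top top_label_through through_top. Qed.

Lemma card_bottom_strands : #|strands bottom_label| = through d.
Proof. exact: side_through rook_bot bottom_label_through through_bot. Qed.

End Rook.

(** * Diagrams with vertical strands *)

Section Parallel.

Variables (K' n : nat).
Let K := K'.+1.
Implicit Types v w : {ffun 'I_n -> option (dots K)}.

(** The diagram with top v and bottom w whose through strands are vertical and
    carry no dots.  It is a partition diagram only if v and w mark the same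
    points; the marks are read from v. *)
Definition parallel v w : prediagram K n n :=
  [ffun B : {set 'I_n + 'I_n} =>
    if [exists k in strands v, B == [set inl k; inr k]] then Some (ord0, ord0)
    else if [pick k | B == [set inr k]] is Some k then v k
    else if [pick k | B == [set inl k]] is Some k then w k
    else None].

Lemma parallel_strand v w k : v k = None -> parallel v w [set inl k; inr k] = Some (ord0, ord0).
Proof.
move=> vk; rewrite ffunE ifT //.
by apply/existsP; exists k; rewrite inE vk !eqxx.
Qed.

Lemma parallel_top v w k : parallel v w [set inr k] = v k.
Proof.
rewrite ffunE ifF; first by rewrite (@pick_set1 _ _ inr) // => ? ? [].
apply/negbTE/existsP => -[j /andP[_ /eqP]].
by move/setP/(_ (inl j)); rewrite !inE eqxx.
Qed.

Lemma parallel_bottom v w k : parallel v w [set inl k] = w k.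
Proof.
rewrite ffunE ifF.
  case: pickP => [j /eqP/setP/(_ (inl k)) | _]; first by rewrite !inE eqxx.
  by rewrite (@pick_set1 _ _ inl) // => ? ? [].
apply/negbTE/existsP => -[j /andP[_ /eqP]].
by move/setP/(_ (inr j)); rewrite !inE eqxx.
Qed.

Variant parallel_spec v w B : option (dots K) -> Prop :=
| ParallelStrand k of v k = None & B = [set inl k; inr k] : parallel_spec v w B (Some (ord0, ord0))
| ParallelTop k o of v k = Some o & B = [set inr k] : parallel_spec v w B (Some o)
| ParallelBottom k o of w k = Some o & B = [set inl k] : parallel_spec v w B (Some o)
| ParallelNone : parallel_spec v w B None.

Lemma parallelP v w B : parallel_spec v w B (parallel v w B).
Proof.
rewrite ffunE; case: ifP => [/existsP[k /andP[]] | _].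
  by rewrite inE => /eqP vk /eqP->; apply: ParallelStrand vk _.
case: pickP => [k /eqP-> | _].
  by case vk: (v k) => [o|]; [apply: ParallelTop vk _ | apply: ParallelNone].
case: pickP => [k /eqP-> | _]; last exact: ParallelNone.
by case wk: (w k) => [o|]; [apply: ParallelBottom wk _ | apply: ParallelNone].
Qed.

Definition column (a : 'I_n + 'I_n) : 'I_n := match a with inl k | inr k => k end.

Lemma parallel_column v w B a b :
  B \in blocks (parallel v w) -> a \in B -> b \in B -> column a = column b.
Proof.
rewrite inE; case: parallelP => //.
- by move=> k _ -> _; rewrite !inE => /orP[]/eqP-> /orP[]/eqP->.
- by move=> k o _ -> _; rewrite !inE => /eqP-> /eqP->.
- by move=> k o _ -> _; rewrite !inE => /eqP-> /eqP->.
Qed.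

Lemma parallel_rook v w : rook_shaped (parallel v w).
Proof.
apply/forall_inP => B Bd; apply/andP.
by split; apply/card_le1_eqP => i j; rewrite !inE => iB jB;
  have := parallel_column Bd iB jB.
Qed.

Lemma top_label_parallel v w : top_label (parallel v w) = v.
Proof. by apply/ffunP => k; rewrite ffunE parallel_top. Qed.

Lemma bottom_label_parallel v w : bottom_label (parallel v w) = w.
Proof. by apply/ffunP => k; rewrite ffunE parallel_bottom. Qed.

Section Matched.

Variables (v w : {ffun 'I_n -> option (dots K)}).
Hypothesis vw : strands v = strands w.

Lemma parallel_None k : (w k == None) = (v k == None).
Proof. by have /setP/(_ k) := vw; rewrite !inE. Qed.

(** The block of [parallel v w] containing the point a. *)
Definition parallel_block (a : 'I_n + 'I_n) : {set 'I_n + 'I_n} :=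
  if v (column a) == None then [set inl (column a); inr (column a)] else [set a].

Lemma mem_parallel_block a : a \in parallel_block a.
Proof.
rewrite /parallel_block; case: ifP => _; last by rewrite inE.
by case: a => k; rewrite !inE eqxx ?orbT.
Qed.

Lemma parallel_block_in a : parallel_block a \in blocks (parallel v w).
Proof.
rewrite /parallel_block inE; case: ifP => [/eqP va | /negbT va].
  by rewrite parallel_strand.
case: a va => k va; last by rewrite parallel_top; case: (v k) va.
by move: va; rewrite parallel_bottom -parallel_None; case: (w k).
Qed.

Lemma parallel_blockE B a :
  B \in blocks (parallel v w) -> a \in B -> B = parallel_block a.
Proof.
rewrite inE /parallel_block; case: parallelP => // [k vk|k o vk|k o wk] -> _; rewrite !inE.
- by case/orP => /eqP-> /=; rewrite vk.
- by move/eqP->; rewrite /= vk.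
- by move/eqP->; rewrite /= -parallel_None wk.
Qed.

Lemma parallel_diagram : is_diagram (parallel v w).
Proof.
apply/and3P; split.
- apply/eqP/setP => a; rewrite inE; apply/bigcupP.
  by exists (parallel_block a); rewrite ?parallel_block_in ?mem_parallel_block.
- apply/trivIsetP => B C Bd Cd; apply: contraNT => /pred0Pn[a /andP[/= aB aC]].
  by rewrite (parallel_blockE Bd aB) (parallel_blockE Cd aC).
- apply/negP => /[!inE]; case: parallelP => // [k _|k o _|k o _] /setP.
  + by move/(_ (inl k)); rewrite !inE eqxx.
  + by move/(_ (inr k)); rewrite !inE eqxx.
  + by move/(_ (inl k)); rewrite !inE eqxx.
Qed.

Lemma parallel_planar : is_planar (parallel v w).
Proof.
apply/forall_inP => B Bd; apply/forall_inP => C Cd; apply/implyP.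
move=> /exists_inP[a aB /exists_inP[b bC /exists_inP[c cB /exists_inP[d dC]]]].
have := parallel_column Bd aB cB; have := parallel_column Cd bC dC.
(* Boundary positions of the two points of a column are nested: a smaller column
   has the larger top position. *)
move: (ltn_ord (column a)) (ltn_ord (column b)) => an bn ac bd.
move: an bn; case: a b c d ac bd {aB bC cB dC} => k [] i [] j [] m /= -> -> *; lia.
Qed.

End Matched.
End Parallel.

(** * Components of a stacked picture *)

Local Notation mid_point k := (inl (inr k)) (only parsing).
Local Notation top_point j := (inr j) (only parsing).

Section Gluing.

Variables (r K n m p : nat) (x : prediagram K m p) (y : prediagram K n m).

Local Notation point := ('I_n + 'I_m + 'I_p)%type.
(* The inclusions of the points of the lower diagram, of the upper diagram and of
   the composite into the points of the stacked picture. *)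
Local Notation low := (@in_lower n m p).
Local Notation up := (@in_upper n m p).
Local Notation outer := (@in_outer n m p).
Implicit Types (u v : point) (Z : {set point}).

(** Two glued points lie in a common block of the lower or of the upper diagram. *)
Variant glued_spec (u v : point) : Prop :=
| GluedLower B a b of B \in blocks y & a \in B & b \in B
    & u = low a & v = low b
| GluedUpper B a b of B \in blocks x & a \in B & b \in B
    & u = up a & v = up b.

Lemma gluedP u v : glued x y u v -> glued_spec u v.
Proof.
case/orP => /exists_inP[B Bd /andP[/imsetP[a aB ->] /imsetP[b bB ->]]].
  exact: GluedLower Bd aB bB _ _.
exact: GluedUpper Bd aB bB _ _.
Qed.

Lemma glued_lower B a b : B \in blocks y -> a \in B -> b \in B ->
  glued x y (low a) (low b).
Proof.
by move=> By aB bB; apply/orP; left; apply/exists_inP; exists B; rewrite ?imset_f.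
Qed.

Lemma glued_upper B a b : B \in blocks x -> a \in B -> b \in B ->
  glued x y (up a) (up b).
Proof.
by move=> By aB bB; apply/orP; right; apply/exists_inP; exists B; rewrite ?imset_f.
Qed.

Lemma glued_connect_sym : connect_sym (glued x y).
Proof.
apply: sym_connect_sym => u v; rewrite /glued.
by congr orb; apply: eq_existsb => B; rewrite andbA andbAC -andbA.
Qed.

Definition component (u : point) : {set point} := [set v | connect (glued x y) u v].

Lemma mem_component u : u \in component u.
Proof. by rewrite inE connect0. Qed.

Lemma component_eq u v : v \in component u -> component v = component u.
Proof.
rewrite inE => uv; apply/setP => w; rewrite !inE.
by rewrite (same_connect glued_connect_sym uv).
Qed.

Lemma component_in u : component u \in components x y.
Proof. exact: imset_f. Qed.

Lemma componentP Z : reflect (exists u, Z = component u) (Z \in components x y).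
Proof. by apply: (iffP imsetP) => [[u _ ->] | [u ->]]; exists u. Qed.

Lemma componentE u (Z : {set point}) :
  u \in Z -> (forall a b, a \in Z -> glued x y a b -> b \in Z) ->
  (forall b, b \in Z -> connect (glued x y) u b) -> component u = Z.
Proof.
move=> uZ Zcl Zconn; apply/setP => v; rewrite inE; apply/idP/idP => [uv | /Zconn //].
rewrite -(closed_connect (a := mem Z) _ uv) //.
by apply: (intro_closed glued_connect_sym) => a b ab aZ; apply: Zcl ab.
Qed.

Lemma outer_pointsE Z o : (o \in outer_points Z) = (outer o \in Z).
Proof. by rewrite inE. Qed.

(** The component is determined by its outer points, since two components with a
    common point coincide; so the choice in the definition of the composition is
    immaterial. *)
Lemma compose_component Z :
  Z \in components x y -> outer_points Z != set0 ->
  compose r x y (outer_points Z)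
    = omap (fun g : 'I_K => (g, inord (component_dots r x y Z).2))
           (insub (component_dots r x y Z).1).
Proof.
move=> Zc Z0; rewrite ffunE; case: pickP => [Z' | /(_ Z)]; last first.
  by rewrite Zc Z0 eqxx.
case/and3P=> Z'c _ /eqP ZZ'; suff -> : Z' = Z by [].
have /set0Pn[o oZ] := Z0; have oZ' := oZ; rewrite -ZZ' in oZ'.
rewrite outer_pointsE in oZ; rewrite outer_pointsE in oZ'.
case/componentP: Zc oZ => u -> /component_eq <-.
by case/componentP: Z'c oZ' => u' -> /component_eq <-.
Qed.

Hypotheses (x_diag : is_diagram x) (y_diag : is_diagram y).

Lemma lower_blocks1 Z : low @^-1: Z \in blocks y ->
  lower_blocks y Z = [set low @^-1: Z].
Proof.
move=> Zy; apply/setP => B; rewrite in_set1; apply/setIdP/eqP => [[By]|->].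
  by rewrite sub_imset_pre => /(block_subset y_diag By Zy).
by rewrite sub_imset_pre.
Qed.

Lemma lower_blocks0 Z : low @^-1: Z = set0 -> lower_blocks y Z = set0.
Proof.
move=> Z0; apply/setP => B; rewrite in_set0; apply/setIdP => -[By].
by rewrite sub_imset_pre Z0 subset0 (negPf (block_neq0 y_diag By)).
Qed.

Lemma upper_blocks1 Z : up @^-1: Z \in blocks x ->
  upper_blocks x Z = [set up @^-1: Z].
Proof.
move=> Zx; apply/setP => B; rewrite in_set1; apply/setIdP/eqP => [[Bx]|->].
  by rewrite sub_imset_pre => /(block_subset x_diag Bx Zx).
by rewrite sub_imset_pre.
Qed.

Lemma upper_blocks0 Z : up @^-1: Z = set0 -> upper_blocks x Z = set0.
Proof.
move=> Z0; apply/setP => B; rewrite in_set0; apply/setIdP => -[Bx].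
by rewrite sub_imset_pre Z0 subset0 (negPf (block_neq0 x_diag Bx)).
Qed.

(** A middle point that is a singleton on both sides is a closed component. *)
Lemma component_mid_closed k a b :
  y [set inr k] = Some a -> x [set inl k] = Some b ->
  component (mid_point k) = [set mid_point k].
Proof.
move=> ya xb; have yk : [set inr k] \in blocks y by rewrite inE ya.
have xk : [set inl k] \in blocks x by rewrite inE xb.
apply: componentE => [|u v|v]; rewrite ?inE // => /eqP-> //.
case/gluedP => B [] // c e By cB eB [kc] ->.
  by rewrite kc in yk; move: eB; rewrite (block1_eq y_diag yk By cB) !inE -kc => /eqP->.
by rewrite kc in xk; move: eB; rewrite (block1_eq x_diag xk By cB) !inE -kc => /eqP->.
Qed.

Lemma component_dots_mid k a b :
  y [set inr k] = Some a -> x [set inl k] = Some b ->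
  component_dots r x y [set mid_point k]
    = dot_reduce r K (a.1 + b.1, a.2 + b.2)%N.
Proof.
move=> ya xb; rewrite /component_dots.
have lowE : low @^-1: [set mid_point k : point] = [set inr k].
  by apply/setP => -[] i; rewrite !inE.
have upE : up @^-1: [set mid_point k : point] = [set inl k].
  by apply/setP => -[] i; rewrite !inE.
have midE : middle_points [set mid_point k : point] = [set k].
  by apply/setP => i; rewrite !inE.
rewrite (lower_blocks1 (Z := [set _])) lowE ?inE ?ya //.
rewrite (upper_blocks1 (Z := [set _])) upE ?inE ?xb //.
rewrite midE !cards1 !big_set1 /handles /moebius ya xb subnn addn0.
by case: a b {ya xb} => [? ?] [? ?].
Qed.

End Gluing.

(** * Closed components of an idempotent *)

Section Weights.

Variables (F : fieldType) (r K : nat) (al be ga : nat -> F).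

(** The scalar that replaces a closed component with reduced dots (g, c). *)
Definition closed_weight (gc : nat * nat) : F :=
  match gc with (g, 0) => al g | (g, 1) => be g | (g, _) => ga g end.

(** The scalar of the closed component obtained by gluing two singletons with dots
    a and b. *)
Definition dots_pairing (a b : dots K) : F :=
  closed_weight (dot_reduce r K (a.1 + b.1, a.2 + b.2)%N).

(** The contribution of a middle point to a Gram matrix entry: on the block of
    labels [Some _] it is the pairing of dots, and marked points pair only with
    marked points, with value 1. *)
Definition label_pairing (o o' : option (dots K)) : F :=
  match o, o' with
  | None, None => 1
  | Some a, Some b => dots_pairing a b
  | _, _ => 0
  end.

Lemma dot_reduce_id g c : (g < K)%N -> (c < 3)%N -> dot_reduce r K (g, c) = (g, c).
Proof.
by move=> gK c3; apply: iter_fix; rewrite /= leqNgt c3 leqNgt gK.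
Qed.

End Weights.

Section SelfComposition.

Variables (F : fieldType) (r K : nat) (al be ga : nat -> F).
Hypothesis rK : (0 < r <= K)%N.
Variables (n : nat) (d : prediagram K n n).
Hypotheses (d_diag : is_diagram d) (d_rook : rook_shaped d).
Hypothesis dd : compose r d d = d.

Local Notation point := ('I_n + 'I_n + 'I_n)%type.

(** If k were marked at the bottom only, with through block {inl k, inr j}, then the
    middle point k would be joined to the top point j and to nothing else, making
    {inr j} a block of the composite. *)
Lemma bottom_strands_subset : strands (bottom_label d) \subset strands (top_label d).
Proof.
apply/subsetP => k; rewrite !inE => /eqP wk.
apply: contraT; rewrite ffunE; case vk: (d [set inr k]) => [a|] // _.
have [j kj] := bottom_label_None d_diag d_rook wk.
have yk : [set inr k] \in blocks d by rewrite inE vk.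
have Zk : component d d (mid_point k) = [set mid_point k; top_point j : point].
  apply: componentE => [|u v|v]; rewrite !inE ?eqxx //.
    case/orP => /eqP->.
      case/gluedP => [B c e By cB eB [kc] -> | B [c|c] e By cB eB // [kc] ->];
        rewrite -kc in cB; move: eB.
        by rewrite (block1_eq d_diag yk By cB) inE => /eqP->; rewrite eqxx.
      rewrite (block_inj d_diag By kj cB) !inE ?eqxx //.
      by case/orP => /eqP->; rewrite eqxx ?orbT.
    case/gluedP => [B c e By cB eB // | B [c|c] e By cB eB // [kc] ->].
    rewrite -kc in cB; move: eB; rewrite (block_inj d_diag By kj cB) !inE ?eqxx ?orbT //.
    by case/orP => /eqP->; rewrite eqxx ?orbT.
  case/orP => /eqP->; first exact: connect0.
  by apply/connect1/(glued_upper _ (a := inl k) (b := inr j) kj); rewrite !inE eqxx ?orbT.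
have Zo : outer_points (component d d (mid_point k)) = [set inr j].
  by rewrite Zk; apply/setP => -[] i; rewrite !inE.
have /= := compose_component r (component_in d d (mid_point k)).
rewrite Zo dd => /(_ _)/esym; rewrite -card_gt0 cards1 => /(_ isT).
have /andP[gK _] : ((component_dots r d d (component d d (mid_point k))).1 < K)%N
    && ((component_dots r d d (component d d (mid_point k))).2 < 3)%N.
  exact: dot_reduceP.
rewrite insubT /= => dj.
have jd : [set inr j] \in blocks d by rewrite inE -dj.
have /setP/(_ (inl k)) := block1_eq d_diag jd kj (set22 _ _).
by rewrite !inE eqxx.
Qed.

Lemma idempotent_strands : strands (top_label d) = strands (bottom_label d).
Proof.
apply/esym/eqP; rewrite eqEcard bottom_strands_subset.
by rewrite (card_top_strands d_diag d_rook) (card_bottom_strands d_diag d_rook) leqnn.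
Qed.

Lemma idempotent_closed_components :
  closed_components d d = [set [set mid_point k : point] | k in ~: strands (top_label d)].
Proof.
have wv k : (bottom_label d k == None) = (top_label d k == None).
  by have /setP/(_ k) := idempotent_strands; rewrite !inE.
have comp_mid k : top_label d k != None ->
    component d d (mid_point k) = [set mid_point k : point].
  move=> vk; have := wv k; rewrite (negPf vk); move: vk; rewrite !ffunE.
  case vk: (d [set inr k]) => [a|] // _; case wk: (d [set inl k]) => [b|] // _.
  exact: component_mid_closed vk wk.
apply/setP => Z; apply/setIdP/imsetP => [[/componentP[u ->] /eqP Zo] | [k]].
  have nZ o : in_outer n o \notin component d d u by rewrite -outer_pointsE Zo inE.
  case: u Zo nZ => [[i|k]|j] Zo nZ.
  - by have := nZ (inl i); rewrite mem_component.
  - have vk : top_label d k != None.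
      apply/negP => /eqP/(top_label_None d_diag d_rook)[i ik].
      have /negP[] := nZ (inl i); rewrite inE; apply/connect1.
      by apply: (glued_lower _ (a := inr k) (b := inl i) ik); rewrite !inE eqxx ?orbT.
    by exists k; rewrite ?comp_mid // !inE.
  - by have := nZ (inr j); rewrite mem_component.
rewrite !inE => vk ->; rewrite -comp_mid //; split; first exact: component_in.
by rewrite comp_mid //; apply/eqP/setP => -[] i; rewrite !inE.
Qed.

Lemma idempotent_closed_scalar :
  closed_scalar r d d al be ga
    = \prod_k label_pairing r al be ga (top_label d k) (bottom_label d k).
Proof.
rewrite /closed_scalar idempotent_closed_components big_imset /=; last first.
  by move=> i j _ _ /set1_inj[].
rewrite big_mkcond; apply: eq_bigr => k _; rewrite !inE.
have /setP/(_ k) := idempotent_strands; rewrite !inE.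
case vk: (top_label d k) => [a|]; case wk: (bottom_label d k) => [b|] // _.
by rewrite ffunE in vk; rewrite ffunE in wk; rewrite (component_dots_mid _ _ _ vk wk).
Qed.

End SelfComposition.

(** * Vertical strands give idempotents *)

Section ParallelIdempotent.

Variables (r K' n : nat).
Let K := K'.+1.
Variables (v w : {ffun 'I_n -> option (dots K)}).
Hypothesis vw : strands v = strands w.

Local Notation e := (parallel v w).
Local Notation point := ('I_n + 'I_n + 'I_n)%type.

(** The column of a point of the stacked picture; gluing preserves it. *)
Definition point_column (u : point) : 'I_n :=
  match u with inl a => column a | inr k => k end.

Lemma point_column_upper a : point_column (in_upper n a) = column a.
Proof. by case: a. Qed.

Lemma point_column_outer a : point_column (in_outer n a) = column a.
Proof. by case: a. Qed.

(** The component of the outer point o: its whole column if it is marked, the point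
    itself otherwise. *)
Definition parallel_component (o : 'I_n + 'I_n) : {set point} :=
  if v (column o) == None
  then [set u | point_column u == column o]
  else [set in_outer n o].

Lemma parallel_componentE o : component e e (in_outer n o) = parallel_component o.
Proof.
rewrite /parallel_component; case: eqP => [vo | /eqP vo].
  set k := column o in vo *.
  have kB : [set inl k; inr k] \in blocks e by rewrite inE parallel_strand.
  have /component_eq -> : in_outer n o \in component e e (mid_point k).
    rewrite inE; apply: connect1; rewrite /k; case: o @k vo kB => k /= vk kB.
      by apply: (glued_lower _ (a := inr k) (b := inl k) kB); rewrite !inE eqxx ?orbT.
    by apply: (glued_upper _ (a := inl k) (b := inr k) kB); rewrite !inE eqxx ?orbT.
  apply: componentE => [|a b|[[i|i]|i]]; rewrite !inE //=.
  - move=> /eqP ak /gluedP[B c f By cB fB ac ->| B c f By cB fB ac ->];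
      move: ak; rewrite ac ?point_column_upper /= => <-;
      by rewrite (parallel_column By cB fB).
  - move=> /eqP->; apply: connect1.
    by apply: (glued_lower _ (a := inr k) (b := inl k) kB); rewrite !inE eqxx ?orbT.
  - by move=> /eqP->; apply: connect0.
  - move=> /eqP->; apply: connect1.
    by apply: (glued_upper _ (a := inl k) (b := inr k) kB); rewrite !inE eqxx ?orbT.
have oB : [set o] \in blocks e.
  by have := parallel_block_in vw o; rewrite /parallel_block (negPf vo).
apply: componentE => [|a b|b]; rewrite ?inE // => /eqP-> //.
have eD := parallel_diagram vw.
case/gluedP => B c f By cB fB.
  case: c cB => c cB; last by case: (o).
  case: o oB {vo} => // k kB [kc] ->; rewrite -kc in cB.
  by move: fB; rewrite (block1_eq eD kB By cB) inE => /eqP->.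
case: c cB => c cB; first by case: (o).
case: o oB {vo} => // k kB [kc] ->; rewrite -kc in cB.
by move: fB; rewrite (block1_eq eD kB By cB) inE => /eqP->.
Qed.

Lemma outer_parallel_component o :
  outer_points (parallel_component o) = parallel_block v o.
Proof.
apply/setP => a; rewrite inE /parallel_component /parallel_block.
case: ifP => _; rewrite !inE.
  by rewrite point_column_outer; case: a => i; rewrite /= ?orbF.
by case: a o => i [].
Qed.

Lemma parallel_component_dots o :
  component_dots r e e (parallel_component o)
    = dot_reduce r K (handles e (parallel_block v o), moebius e (parallel_block v o)).
Proof.
have eD := parallel_diagram vw.
have oB := parallel_block_in vw o.
rewrite /component_dots; move: oB; rewrite /parallel_component /parallel_block.
case: ifP => [vo | _] oB.
  set Z := [set u | _]; set k := column o in Z vo oB *.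
  have lowE : (@in_lower n n n) @^-1: Z = [set inl k; inr k].
    by apply/setP => -[] i; rewrite !inE /= ?orbF.
  have upE : (@in_upper n n n) @^-1: Z = [set inl k; inr k].
    by apply/setP => -[] i; rewrite !inE /= ?orbF.
  have midE : middle_points Z = [set k] by apply/setP => i; rewrite !inE.
  rewrite (lower_blocks1 eD) lowE ?(upper_blocks1 eD) ?upE // midE !big_set1 !cards1.
  by rewrite /handles /moebius parallel_strand //; apply/eqP.
case: o oB => k kB; set Z := [set _].
  have lowE : (@in_lower n n n) @^-1: Z = [set inl k].
    by apply/setP => -[] i; rewrite !inE.
  have upE : (@in_upper n n n) @^-1: Z = set0.
    by apply/setP => -[] i; rewrite !inE.
  have midE : middle_points Z = set0 by apply/setP => i; rewrite !inE.
  rewrite (lower_blocks1 eD) lowE // (upper_blocks0 eD) //.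
  by rewrite midE !big_set1 !big_set0 !cards1 !cards0 !addn0.
have lowE : (@in_lower n n n) @^-1: Z = set0.
  by apply/setP => -[] i; rewrite !inE.
have upE : (@in_upper n n n) @^-1: Z = [set inr k].
  by apply/setP => -[] i; rewrite !inE.
have midE : middle_points Z = set0 by apply/setP => i; rewrite !inE.
rewrite (upper_blocks1 eD) upE // (lower_blocks0 eD) //.
by rewrite midE !big_set1 !big_set0 !cards1 !cards0 !addn0.
Qed.

Lemma parallel_idempotent : compose r e e = e.
Proof.
have eo o : compose r e e (parallel_block v o) = e (parallel_block v o).
  have oB := parallel_block_in vw o.
  have := compose_component r (component_in e e (in_outer n o)).
  rewrite parallel_componentE outer_parallel_component => -> //; first last.
    by have := block_neq0 (parallel_diagram vw) oB.
  rewrite parallel_component_dots /handles /moebius.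
  move: oB; rewrite inE; case: (e _) => [[g c]|] // _.
  by rewrite dot_reduce_id //= valK /= inord_val.
apply/ffunP => B; case eB: (e B) => [gc|].
  have Be : B \in blocks e by rewrite inE eB.
  have /set0Pn[o oB] := block_neq0 (parallel_diagram vw) Be.
  by rewrite -eB (parallel_blockE vw Be oB) eo.
rewrite ffunE; case: pickP => // Z /and3P[/componentP[u ->] B0 /eqP uB].
have /set0Pn[o] := B0; rewrite -uB outer_pointsE => /component_eq uo.
move: uB; rewrite -uo parallel_componentE outer_parallel_component => Bo.
by have := parallel_block_in vw o; rewrite Bo inE eB.
Qed.

End ParallelIdempotent.

(** * Gram matrices of rook-shaped cells *)

Section Gram.

Variables (F : fieldType) (r K' : nat) (al be ga : nat -> F).
Let K := K'.+1.
Hypothesis rK : (0 < r <= K)%N.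
Variables (f : diagram_family) (n l : nat).
Hypothesis rook_l : forall e : diagram f K n, through e = l -> rook_shaped e.
Hypothesis parallel_l : forall v w : {ffun 'I_n -> option (dots K)},
  strands v = strands w -> #|strands v| = l -> in_family f (parallel v w).

Lemma in_family_diagram (e : diagram f K n) : is_diagram e.
Proof. by case: e => e /= /and3P[]. Qed.

Lemma md_mul_basis (e z : diagram f K n) :
  md_mul r al be ga (basis_elt F e) (basis_elt F e) z
    = if compose r e e == z :> prediagram K n n then closed_scalar r e e al be ga else 0.
Proof.
rewrite ffunE (bigD1 e) //= [X in _ + X]big1 ?addr0 => [|x xe]; last first.
  by rewrite big1 // => y _; rewrite ffunE (negPf xe) !mul0r.
rewrite big_mkcond (bigD1 e) //= [X in _ + X]big1 ?addr0 => [|y ye].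
  by rewrite !ffunE eqxx !mul1r.
by rewrite [X in _ * X * _]ffunE (negPf ye) mulr0 mul0r if_same.
Qed.

Lemma sq_coefE (e : diagram f K n) :
  sq_coef r al be ga e
    = if compose r e e == e :> prediagram K n n then closed_scalar r e e al be ga else 0.
Proof. exact: md_mul_basis. Qed.

Lemma sq_coef_idempotent (e : diagram f K n) : sq_coef r al be ga e != 0 ->
  compose r e e = e /\ sq_coef r al be ga e = closed_scalar r e e al be ga.
Proof.
by rewrite sq_coefE; case: (compose r e e =P dval e) => // _; rewrite eqxx.
Qed.

Lemma cell_labels (e : diagram f K n) : through e = l ->
  [/\ top_half e = half_of (top_label e), bottom_half e = half_of (bottom_label e),
      top_label e \in labellings K n l & bottom_label e \in labellings K n l].
Proof.
move=> el; have eD := in_family_diagram e; have eR := rook_l el.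
rewrite !inE rook_top_half ?rook_bottom_half //.
by rewrite card_top_strands ?card_bottom_strands // el.
Qed.

Lemma parallel_cell v w (vw : strands v = strands w) (vl : #|strands v| = l) :
  exists2 e : diagram f K n, e = parallel v w :> prediagram K n n
    & e \in Hcell f l (half_of v) (half_of w).
Proof.
exists (Diagram (parallel_l vw vl)) => //; rewrite inE /=.
have eD := parallel_diagram vw; have eR := parallel_rook v w.
rewrite (rook_top_half eD eR) (rook_bottom_half eD eR) -(card_top_strands eD eR).
by rewrite top_label_parallel bottom_label_parallel vl !eqxx.
Qed.

Lemma cell_topsE : cell_tops K f n l = @half_of K n @: labellings K n l.
Proof.
apply/setP => t; apply/imsetP/imsetP => [[e el ->] | [v vl ->]].
  move: el; rewrite inE => /eqP/cell_labels[-> _ vl _].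
  by exists (top_label e).
move: vl; rewrite inE => /eqP/(parallel_cell (erefl _))[e _].
by rewrite inE => /and3P[el /eqP<- _]; exists e; rewrite ?inE.
Qed.

Lemma cell_bottomsE : cell_bottoms K f n l = @half_of K n @: labellings K n l.
Proof.
apply/setP => t; apply/imsetP/imsetP => [[e el ->] | [v vl ->]].
  move: el; rewrite inE => /eqP/cell_labels[_ -> _ vl].
  by exists (bottom_label e).
move: vl; rewrite inE => /eqP/(parallel_cell (erefl _))[e _].
by rewrite inE => /and3P[el _ /eqP<-]; exists e; rewrite ?inE.
Qed.

Lemma gram_entryE v w : v \in labellings K n l -> w \in labellings K n l ->
  gram_entry r al be ga f l (half_of v) (half_of w)
    = \prod_k label_pairing r al be ga (v k) (w k).
Proof.
rewrite !inE => /eqP vl /eqP wl.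
rewrite /gram_entry; case: pickP => [e /andP[]|none].
  rewrite inE => /and3P[/eqP el /eqP et /eqP eb] /andP[/sq_coef_idempotent[ee ->] _].
  have eD := in_family_diagram e; have eR := rook_l el.
  rewrite (idempotent_closed_scalar al be ga rK eD eR ee).
  have [te be' _ _] := cell_labels el.
  have <- : top_label e = v by apply: (can_inj (@half_ofK K n)); rewrite -te et.
  by have <- : bottom_label e = w by apply: (can_inj (@half_ofK K n)); rewrite -be' eb.
apply/esym/eqP; apply: contraT => /prodf_neq0 nz.
have vw : strands v = strands w.
  apply/setP => k; rewrite !inE; have := nz k isT.
  by case: (v k) => [a|]; case: (w k) => [b|] //= /eqP.
have [e ee ec] := parallel_cell vw vl.
have eE : compose r e e = e by rewrite ee; apply: parallel_idempotent.
have eS : sq_coef r al be ga e = \prod_k label_pairing r al be ga (v k) (w k).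
  rewrite sq_coefE eE eqxx (idempotent_closed_scalar al be ga rK) //; last first.
  - by rewrite ee; apply: parallel_rook.
  - exact: in_family_diagram.
  by rewrite ee top_label_parallel bottom_label_parallel.
have /negP[] := none e; rewrite ec eS; apply/andP; split=> //; apply/andP; split.
  by apply/prodf_neq0 => k _; apply: nz.
apply/eqP/ffunP => z; rewrite md_mul_basis ffunE [basis_elt _ _ _]ffunE eE.
rewrite -eS sq_coefE eE eqxx val_eqE eq_sym.
by case: eqP => _; [rewrite /GRing.scale /= mulr1 | rewrite scaler0].
Qed.

(** The inverse of the Gram matrix is the product over the points of an inverse of
    the label pairing.  When l = n all points are marked and the pairing of dots
    plays no role, so no inverse of it is required. *)
Section Rank.

Variable inv : dots K -> dots K -> F.
Hypothesis pairing_inv : (l < n)%N -> forall a b,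
  \sum_c dots_pairing r al be ga a c * inv c b = (a == b)%:R.

Definition label_inv (o o' : option (dots K)) : F :=
  match o, o' with
  | None, None => 1
  | Some a, Some b => inv a b
  | _, _ => 0
  end.

Lemma label_pairing_inv o o' : (l < n)%N || (o == None) && (o' == None) ->
  \sum_c label_pairing r al be ga o c * label_inv c o' = (o == o')%:R.
Proof.
have sum_option (G : option (dots K) -> F) : \sum_c G c = G None + \sum_c G (Some c).
  rewrite (bigD1 None) //=; congr (_ + _).
  rewrite (reindex_omap Some id) => [|[c|]] //.
  by apply: eq_bigl => c; rewrite /= eqxx.
rewrite sum_option; case: o o' => [a|] [b|] /=; rewrite ?orbF => ln.
- by rewrite mul0r add0r pairing_inv.
- by rewrite mul0r add0r big1 // => c _; rewrite mulr0.
- by rewrite mulr0 add0r big1 // => c _; rewrite mul0r.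
- by rewrite mul1r big1 ?addr0 // => c _; rewrite mul0r.
Qed.

Lemma sum_label_inv u v : u \in labellings K n l -> v \in labellings K n l ->
  \sum_(w in labellings K n l)
     (\prod_k label_pairing r al be ga (u k) (w k)) * \prod_k label_inv (w k) (v k)
  = (u == v)%:R.
Proof.
rewrite !inE => /eqP ul /eqP vl.
have -> : (u == v)%:R = \prod_k ((u k == v k)%:R : F).
  case: eqP => [-> | uv]; first by rewrite big1 // => k _; rewrite eqxx.
  apply/esym/eqP/prodf_eq0.
  have /existsP[k uvk] : [exists k, u k != v k].
    by apply: contraT => /existsPn uv'; case: uv; apply/ffunP => k; apply/eqP/negPn/uv'.
  by exists k; rewrite ?(negPf uvk).
under [RHS]eq_bigr => k _.
  rewrite -label_pairing_inv; last first.
    have [//|nl /=] := ltnP l n.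
    have all_None (x : {ffun 'I_n -> option (dots K)}) : #|strands x| = l -> x k = None.
      move=> xl; have /eqP xT : strands x == setT.
        by rewrite eqEcard subsetT cardsT card_ord xl.
      by have /setP/(_ k) := xT; rewrite !inE => /eqP.
    by rewrite !all_None.
  over.
(* The product of sums runs over all labellings; a labelling with a different
   set of marked points contributes 0, because one factor of its pairing with u
   is mixed. *)
rewrite bigA_distr_bigA /= [RHS](bigID (mem (labellings K n l))) /=.
rewrite [X in _ + X]big1 ?addr0 => [|w].
  by apply: eq_bigr => w _; rewrite big_split.
rewrite inE => wl; rewrite big_split /=.
suff -> : \prod_k label_pairing r al be ga (u k) (w k) = 0 by rewrite mul0r.
apply/eqP; apply: contraNT wl => /prodf_neq0 nz; rewrite -ul.
apply/eqP/eq_card => k; rewrite !inE; have := nz k isT.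
by case: (u k) => [a|]; case: (w k) => [b|] //= /eqP.
Qed.

Lemma gram_rank : \rank (gram r K al be ga f n l) = ('C(n, l) * (K * 3) ^ (n - l))%N.
Proof.
have half_inj := can_inj (@half_ofK K n).
transitivity #|cell_tops K f n l|; last first.
  by rewrite cell_topsE card_imset // card_labellings.
apply/eqP/row_freeP.
exists (\matrix_(j, i) \prod_k label_inv (label_of (enum_val j) k) (label_of (enum_val i) k)).
apply/matrixP => i i'; rewrite !mxE.
under eq_bigr => j _ do rewrite !mxE.
rewrite -(big_enum_val (fun y => gram_entry r al be ga f l (enum_val i) y
  * \prod_k label_inv (label_of y k) (label_of (enum_val i') k))).
have := enum_valP i; have := enum_valP i'; rewrite -(inj_eq enum_val_inj).
move: (enum_val i) (enum_val i') => t t'.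
rewrite cell_topsE cell_bottomsE => /imsetP[v vl ->] /imsetP[u ul ->].
rewrite big_imset /=; last by move=> ? ? _ _; apply: half_inj.
rewrite (inj_eq half_inj) half_ofK -(sum_label_inv ul vl).
by apply: eq_bigr => w wl; rewrite gram_entryE // half_ofK.
Qed.

End Rank.
End Gram.

(** * Families in which the cells are rook-shaped *)

Section Families.

Variables (K n : nat) (d : prediagram K n n).
Hypothesis d_diag : is_diagram d.

(** Apart from B, each through block uses at least one point of the side h. *)
Lemma leq_through_side (h : 'I_n -> 'I_n + 'I_n) B :
  (forall C, is_through C -> h @^-1: C != set0) -> B \in blocks d ->
  (through d + #|h @^-1: B| <= n + is_through B)%N.
Proof.
move=> through_h Bd.
have h_through C : C \in through_blocks d -> h @^-1: C != set0.
  by case/setIdP=> _ /through_h.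
have sub_blocks : through_blocks d \subset blocks d.
  by apply/subsetP => C /setIdP[].
have := card_blocks_meeting d_diag sub_blocks Bd h_through.
rewrite /through (cardsD1 B (through_blocks d)).
have -> : (B \in through_blocks d) = is_through B by apply/setIdP/idP => [[] | ].
lia.
Qed.

Lemma leq_through_bot B : B \in blocks d ->
  (through d + #|bot_part B| <= n + is_through B)%N.
Proof.
by move=> Bd; rewrite bot_partE; apply: (leq_through_side (@through_bot n) Bd).
Qed.

Lemma leq_through_top B : B \in blocks d ->
  (through d + #|top_part B| <= n + is_through B)%N.
Proof.
by move=> Bd; rewrite top_partE; apply: (leq_through_side (@through_top n) Bd).
Qed.

Lemma leq_card_parts (B : {set 'I_n + 'I_n}) : (#|bot_part B| + #|top_part B| <= #|B|)%N.
Proof.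
rewrite -(card_imset (bot_part B) (@inl_inj _ 'I_n)).
rewrite -(card_imset (top_part B) (@inr_inj 'I_n _)).
have I0 : (@inl _ 'I_n @: bot_part B) :&: (@inr 'I_n _ @: top_part B) = set0.
  apply/setP => a; rewrite !inE; apply/negP => /andP[/imsetP[i _ ->] /imsetP[j _]].
  by [].
rewrite -cardsUI I0 cards0 addn0.
by apply/subset_leq_card/subUsetP; split; apply/subsetP => _ /imsetP[k + ->]; rewrite inE.
Qed.

Lemma rook_full : through d = n -> rook_shaped d.
Proof.
move=> dn; apply/forall_inP => B Bd.
have := leq_through_bot Bd; have := leq_through_top Bd.
by rewrite dn !leq_add2l; case: is_through => ? ?; apply/andP; split; lia.
Qed.

Lemma rook_almost_full : n = (through d).+1 ->
  (forall B, B \in blocks d -> #|B| <= 2)%N -> rook_shaped d.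
Proof.
move=> dn B2; apply/forall_inP => B Bd.
case tB: (is_through B).
  have /andP[] := tB; rewrite -!card_gt0 => b0 t0.
  have := leq_trans (leq_card_parts B) (B2 B Bd).
  by move=> ?; apply/andP; split; lia.
have := leq_through_bot Bd; have := leq_through_top Bd; rewrite tB => ? ?.
by apply/andP; split; lia.
Qed.

End Families.

Section ParallelFamilies.

Variables (K' n : nat).
Let K := K'.+1.
Variables (v w : {ffun 'I_n -> option (dots K)}).
Hypothesis vw : strands v = strands w.

Lemma parallel_in_family f :
  (forall B, B \in blocks (parallel v w) -> block_shape f B) ->
  in_family f (parallel v w).
Proof.
move=> fB; rewrite /in_family parallel_diagram //= parallel_planar ?implybT ?andbT //.
exact/forall_inP.
Qed.

Lemma parallel_full f : #|strands v| = n -> in_family f (parallel v w).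
Proof.
move=> vn; apply: parallel_in_family => B Bp.
have /set0Pn[a aB] := block_neq0 (parallel_diagram vw) Bp.
rewrite (parallel_blockE vw Bp aB) /parallel_block.
have /eqP sT : strands v == setT by rewrite eqEcard subsetT cardsT card_ord vn leqnn.
have /setP/(_ (column a)) := sT; rewrite !inE => ->; set k := column a.
have b1 : bot_part [set inl k; inr k] = [set k].
  by apply/setP => i; rewrite !inE orbF.
have t1 : top_part [set inl k; inr k] = [set k].
  by apply/setP => i; rewrite !inE.
by case: f => /=; rewrite ?b1 ?t1 ?cards1 ?cards2.
Qed.

Lemma parallel_rook_family f : f = Ro \/ f = RoP -> in_family f (parallel v w).
Proof.
move=> fE; apply: parallel_in_family => B Bp.
by have := forall_inP (parallel_rook v w) B Bp; case: fE => ->.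
Qed.

Lemma parallel_motzkin_family f : f = RoBr \/ f = Mo -> in_family f (parallel v w).
Proof.
move=> fE; apply: parallel_in_family => B Bp.
suff: (#|B| <= 2)%N by case: fE => ->.
have /set0Pn[a aB] := block_neq0 (parallel_diagram vw) Bp.
rewrite (parallel_blockE vw Bp aB) /parallel_block.
by case: ifP; rewrite ?cards1 ?cards2.
Qed.

End ParallelFamilies.

(** * Moebius dots only *)

Section TrivialHandles.

Variables (F : fieldType) (a b c : F).

Lemma rank_condition_neq0 m : rank_condition a b c m.+1 != 0 ->
  a - c != 0 /\ c ^+ 2 - b ^+ 2 != 0.
Proof.
rewrite /rank_condition big_ltn // [X in _ - X]big_geq // subr0 !expr1.
rewrite bin1 subSS subn0 !mulf_eq0 !expf_eq0 !muln_gt0 !expn_gt0 /=.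
by rewrite !negb_or => /andP[/andP[-> _] ->].
Qed.

(** The inverse of the matrix with rows (a, b, c), (b, c, b), (c, b, c). *)
Definition pairing_inverse (x y : dots 1) : F :=
  match val x.2, val y.2 with
  | 0, 0 => (a - c)^-1
  | 0, 2 | 2, 0 => - (a - c)^-1
  | 1, 1 => c / (c ^+ 2 - b ^+ 2)
  | 1, 2 | 2, 1 => - (b / (c ^+ 2 - b ^+ 2))
  | 2, 2 => (a - c)^-1 + c / (c ^+ 2 - b ^+ 2)
  | _, _ => 0
  end.

Lemma pairing_inverseE (al be ga : nat -> F) : al 0%N = a -> be 0%N = b -> ga 0%N = c ->
  a - c != 0 -> c ^+ 2 - b ^+ 2 != 0 -> forall x y : dots 1,
  \sum_z dots_pairing 1 al be ga x z * pairing_inverse z y = (x == y)%:R.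
Proof.
move=> aE bE cE D0 E0 x y.
rewrite -(pair_bigA _ (fun i j => dots_pairing 1 al be ga x (i, j) * pairing_inverse (i, j) y)) /=.
rewrite big_ord1 !big_ord_recl big_ord0 addr0.
rewrite /dots_pairing /pairing_inverse.
have -> : (x == y) = (val x.2 == val y.2).
  by case: x y => [i k] [j m]; rewrite xpair_eqE [i]ord1 [j]ord1 eqxx.
case: x y => [i k] [j m] /=; rewrite [i]ord1 /=.
case: k m => [[|[|[|//]]] ?] [[|[|[|//]]] ?] /=; rewrite ?aE ?bE ?cE.
all: by field; rewrite ?D0 ?E0.
Qed.

End TrivialHandles.

Theorem proposition6p0p6 (F : fieldType) (r : nat) (pal pbe pga : {poly F})
    (K : nat) (al be ga : nat -> F) (n : nat)
    (r_odd : odd r)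
    (K_def : K = maxn (size pal) r)
    (deg_be : (size pbe <= K)%N)
    (deg_ga : (size pga <= K)%N)
    (al_def : expansion al pal (1 - 'X^r))
    (be_def : expansion be pbe (1 - 'X^r))
    (ga_def : expansion ga pga (1 - 'X^r)) :
  (forall f : diagram_family,
     is_apex r K al be ga f n n ->
     \rank (gram r K al be ga f n n) = 1%N)
  /\
  (r = 1%N ->
   expansion al (al 0%N)%:P (1 - 'X) ->
   expansion be (be 0%N)%:P (1 - 'X) ->
   expansion ga (ga 0%N)%:P (1 - 'X) ->
   (forall (f : diagram_family) (l : nat),
      f = Ro \/ f = RoP ->
      is_apex r K al be ga f n l ->
      rank_condition (al 0%N) (be 0%N) (ga 0%N) (n - l) != 0 ->
      \rank (gram r K al be ga f n l) = ('C(n, l) * 3 ^ (n - l))%N)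
   /\
   (forall (f : diagram_family) (l : nat),
      f = RoBr \/ f = Mo ->
      n = l.+1 ->
      is_apex r K al be ga f n l ->
      rank_condition (al 0%N) (be 0%N) (ga 0%N) (n - l) != 0 ->
      \rank (gram r K al be ga f n l) = (3 * n)%N)).
Proof.
have r_gt0 : (0 < r)%N by case: r r_odd {K_def al_def be_def ga_def}.
have rK : (0 < r <= K)%N by rewrite r_gt0 K_def leq_maxr.
split=> [f _|r1 al_geo _ _].
  case: K rK {K_def deg_be deg_ga} => [|K']; first by rewrite leqn0 andbC; case: eqP r_gt0 => // ->.
  move=> rK; rewrite (gram_rank rK _ _ (inv := fun _ _ => 0)).
  - by rewrite binn subnn.
  - by move=> e; apply: rook_full; apply: in_family_diagram.
  - by move=> v w vw vn; apply: parallel_full.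
  - by rewrite ltnn.
(* Both expansions describe the same series with the same denominator, so that
   pal is constant. *)
have K1 : K = 1%N.
  rewrite K_def r1; apply/maxn_idPr; suff -> : pal = (al 0%N)%:P by apply: size_polyC_leq1.
  by apply/polyP => k; rewrite -al_def -al_geo r1 expr1.
rewrite {}K1 {}r1 in rK *.
have inv_l l : (0 < n - l)%N -> rank_condition (al 0%N) (be 0%N) (ga 0%N) (n - l) != 0 ->
  forall x y : dots 1, \sum_z dots_pairing 1 al be ga x z
    * pairing_inverse (al 0%N) (be 0%N) (ga 0%N) z y = (x == y)%:R.
  case: (n - l)%N => // m _ /rank_condition_neq0[D0 E0].
  exact: pairing_inverseE.
split=> f l fE => [_ | nl _] rc.
  rewrite (gram_rank rK _ _ (inv := pairing_inverse (al 0%N) (be 0%N) (ga 0%N))) ?mul1n //.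
  - move=> e _; have /and3P[_ eB _] := valP e; apply/forall_inP => B Be.
    by have := forall_inP eB B Be; case: fE => ->.
  - by move=> v w vw _; apply: parallel_rook_family.
  - by rewrite -subn_gt0 => /inv_l; apply.
rewrite (gram_rank rK _ _ (inv := pairing_inverse (al 0%N) (be 0%N) (ga 0%N))).
- by rewrite nl subSnn binSn mul1n expn1 mulnC.
- move=> e el; apply: rook_almost_full; rewrite ?el //; first exact: in_family_diagram.
  have /and3P[_ eB _] := valP e => B Be.
  by have := forall_inP eB B Be; case: fE => ->.
- by move=> v w vw _; apply: parallel_motzkin_family.
- by rewrite -subn_gt0 => /inv_l; apply.
Qed.
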